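(* Let $n\geq 2$ be an integer and let $\varepsilon>0$. There exists a Jordan-measurable set $A\subseteq\mathbb{R}^n$ (i.e., a set whose boundary has Lebesgue measure $0$) of infinite volume such that every $n$-dimensional parallelotope with all $2^n$ vertices in $A$ has volume less than $\varepsilon$.
   Context: An $n$-dimensional parallelotope in $\mathbb{R}^n$ has vertices $p+\sum_{j\in T}v_j$, $T\subseteq\{1,\ldots,n\}$, where $p\in\mathbb{R}^n$ and $v_1,\ldots,v_n\in\mathbb{R}^n$ are linearly independent; its volume is $|\det(v_1,\ldots,v_n)|$. *)

(* Defs.v *)
From HB Require Import structures.
From mathcomp Require Import all_boot all_order all_algebra.
From mathcomp Require Import all_classical all_reals all_analysis.

Set Implicit Arguments.
Unset Strict Implicit.
Unset Printing Implicit Defensive.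

Import Order.TTheory GRing.Theory Num.Theory.
Import numFieldNormedType.Exports.

Local Open Scope classical_set_scope.
Local Open Scope ring_scope.

Definition half_open_box (R : realType) (n : nat) (a b : 'rV[R]_n) :
  set 'rV[R]_n := [set x | forall i : 'I_n, a 0 i < x 0 i <= b 0 i].

(* The side conditions [a i <= b i] keep the side lengths, hence the volumes,
   nonnegative; degenerate (empty) boxes are allowed. *)
Definition box_cover (R : realType) (n : nat) (A : set 'rV[R]_n) :
  set (nat -> 'rV[R]_n * 'rV[R]_n) :=
  [set ab : nat -> 'rV[R]_n * 'rV[R]_n |
    (forall k (i : 'I_n), (ab k).1 0 i <= (ab k).2 0 i) /\
    A `<=` \bigcup_k half_open_box (ab k).1 (ab k).2].

Definition box_volume (R : realType) (n : nat) (a b : 'rV[R]_n) : R :=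
  \prod_(i < n) (b 0 i - a 0 i).

(* n-dimensional Lebesgue (outer) measure, for which the library only has the
   case n = 1: the infimum of the total volumes of countable box covers.  It is
   the Lebesgue measure on every Lebesgue-measurable set, in particular on null
   sets and on every set with null boundary (such a set differs from its
   interior by a subset of its boundary). *)
Definition lebesgue_volume (R : realType) (n : nat) (A : set 'rV[R]_n) : \bar R :=
  ereal_inf [set (\sum_(0 <= k <oo) (box_volume (ab k).1 (ab k).2)%:E)%E
            | ab in box_cover A].

Definition boundary (T : topologicalType) (A : set T) : set T :=
  closure A `\` interior A.

(* Boundedness is not required, so that infinite volume is possible. *)
Definition jordan_measurable (R : realType) (n : nat) (A : set 'rV[R]_n) : Prop :=
  lebesgue_volume (boundary A) = 0%E.

(* The vectors v_1, ..., v_n of a parallelotope are the rows of a matrix v. *)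
Definition parallelotope_vertex (R : realType) (n : nat)
    (p : 'rV[R]_n) (v : 'M[R]_n) (T : {set 'I_n}) : 'rV[R]_n :=
  p + \sum_(j in T) row j v.

Definition parallelotope_volume (R : realType) (n : nat) (v : 'M[R]_n) : R :=
  `|\det v|.

(* Main.v *)
(* Let A be a staircase of boxes below the hyperbola x_0 x_(n-1) = c, with x_0
   unbounded and 0 < x_i <= 1 for the other coordinates; every dyadic step has
   volume c/2.  Suppose that a parallelotope has its vertices in A.  If i <> j,
   then one of the two edges in direction v_i among p, p + v_i, p + v_j,
   p + v_i + v_j lies in x_0 >= |v_j0|, so there |v_j0| x_(n-1) <= c at both
   ends and |v_j0| |v_i(n-1)| <= c.  The other factors of a term of the Leibniz
   formula are at most 1, so |det v| <= n! c. *)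
Require Import Defs.
From mathcomp Require Import all_boot all_order all_algebra.
From mathcomp Require Import all_classical all_reals all_analysis.
From mathcomp Require Import measurable_realfun perm ring lra.

Set Implicit Arguments.
Unset Strict Implicit.
Unset Printing Implicit Defensive.

Import Order.TTheory GRing.Theory Num.Theory.
Import numFieldNormedType.Exports.

Local Open Scope classical_set_scope.
Local Open Scope ring_scope.

(** * Integrals of series of step functions *)

Lemma measurable_weighted_itv (R : realType) (u a b : R) :
  measurable_fun [set: R] (fun t => (u * (a < t <= b)%R%:R)%:E).
Proof.
apply/measurable_EFinP; apply: measurable_funM => //.
rewrite (_ : (fun t : R => _) = \1_`]a, b]); last first.
  by apply/funext => t; rewrite indicE mem_setE in_itv.
exact: measurable_indic.
Qed.

(** Monotone convergence allows integration term by term. *)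
Lemma integral_series_itv (R : realType) (u a b : nat -> R) :
  (forall k, 0 <= u k) -> (forall k, a k <= b k) ->
  (\int[lebesgue_measure]_t
      \sum_(0 <= k <oo) (u k * (a k < t <= b k)%R%:R)%:E =
   \sum_(0 <= k <oo) (u k * (b k - a k))%:E)%E.
Proof.
move=> u_ge0 le_ab.
rewrite integral_nneseries //; last first.
- by move=> k t _; rewrite lee_fin mulr_ge0.
- by move=> k; exact: measurable_weighted_itv.
apply: eq_eseriesr => k _.
under eq_integral do rewrite EFinM.
rewrite ge0_integralZl_EFin //; last first.
  have := @measurable_weighted_itv R 1 (a k) (b k).
  by under eq_fun do rewrite mul1r.
rewrite (_ : (fun t : R => _) = fun t => (\1_`]a k, b k] t)%:E); last first.
  by apply/funext => t; rewrite indicE mem_setE in_itv.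
rewrite integral_indic // setIT.
rewrite [X in (_ * X)%E](_ : _ = (b k - a k)%:E) ?EFinM //.
apply: etrans (lebesgue_measure_itv `]a k, b k]) _; rewrite /= lte_fin.
have := le_ab k; rewrite le_eqVlt => /predU1P [-> | ->]; last by rewrite EFinB.
by rewrite ltxx subrr.
Qed.

Lemma measurable_series_itv (R : realType) (u a b : nat -> R) :
  (forall k, 0 <= u k) ->
  measurable_fun [set: R]
    (fun t => \sum_(0 <= k <oo) (u k * (a k < t <= b k)%R%:R)%:E)%E.
Proof.
move=> u_ge0; apply: ge0_emeasurable_sum => [k t _ _|k _].
  by rewrite lee_fin mulr_ge0.
exact: measurable_weighted_itv.
Qed.

(* Fubini for step functions, by integrating out one coordinate at a time; the
   points are sequences, of which only the first [n] terms matter. *)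
Lemma le_series_box_volume (R : realType) (n : nat) (u w : nat -> R)
    (a b c d : nat -> nat -> R) :
  (forall k, 0 <= u k) -> (forall k, 0 <= w k) ->
  (forall k i, a k i <= b k i) -> (forall k i, c k i <= d k i) ->
  (forall x : nat -> R,
    \sum_(0 <= k <oo) (u k * \prod_(i < n) (a k i < x i <= b k i)%R%:R)%:E <=
    \sum_(0 <= k <oo) (w k * \prod_(i < n) (c k i < x i <= d k i)%R%:R)%:E)%E ->
  (\sum_(0 <= k <oo) (u k * \prod_(i < n) (b k i - a k i))%:E <=
   \sum_(0 <= k <oo) (w k * \prod_(i < n) (d k i - c k i))%:E)%E.
Proof.
elim: n u w => [|n IHn] u w u_ge0 w_ge0 le_ab le_cd le_uw.
  have := le_uw (fun=> 0).
  by under eq_eseriesr do rewrite !big_ord0;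
    under [X in (_ <= X)%E -> _]eq_eseriesr do rewrite !big_ord0;
    under [X in _ -> (X <= _)%E]eq_eseriesr do rewrite !big_ord0;
    under [X in _ -> (_ <= X)%E]eq_eseriesr do rewrite !big_ord0.
have vol_ge0 (e f : nat -> nat -> R) (v : nat -> R) :
    (forall k, 0 <= v k) -> (forall k i, e k i <= f k i) ->
    forall k, 0 <= v k * \prod_(i < n) (f k i - e k i).
  by move=> v_ge0 le_ef k; rewrite mulr_ge0 ?prodr_ge0 // => i _; rewrite subr_ge0.
have split_vol (e f : nat -> nat -> R) (v : nat -> R) (k : nat) :
    v k * \prod_(i < n.+1) (f k i - e k i) =
    v k * \prod_(i < n) (f k i - e k i) * (f k n - e k n).
  by rewrite big_ord_recr /= mulrA.
under eq_eseriesr do rewrite split_vol.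
under [X in (_ <= X)%E]eq_eseriesr do rewrite split_vol.
(* The last side lengths become integrals over the last coordinate, so it suffices to compare the
   integrands. *)
rewrite -!integral_series_itv //; try exact: vol_ge0.
apply: ge0_le_integral => //.
- by move=> t _; apply: nneseries_ge0 => k _ _; rewrite lee_fin mulr_ge0 ?vol_ge0.
- by apply: measurable_series_itv; exact: vol_ge0.
- by apply: measurable_series_itv; exact: vol_ge0.
move=> t _.
(* For fixed [t] the indicators of the last coordinate join the weights, which are arbitrary
   nonnegative numbers in [IHn]. *)
under eq_eseriesr do rewrite mulrAC.
under [X in (_ <= X)%E]eq_eseriesr do rewrite mulrAC.
apply: IHn => // [k|k|x]; try by rewrite mulr_ge0.
have := le_uw (fun i => if i == n then t else x i).
have split_ind (e f : nat -> nat -> R) (v : nat -> R) (k : nat) :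
    v k * \prod_(i < n.+1) (e k i < (if i == n :> nat then t else x i) <= f k i)%R%:R =
    v k * (e k n < t <= f k n)%R%:R * \prod_(i < n) (e k i < x i <= f k i)%R%:R.
  rewrite big_ord_recr /= eqxx [X in _ * X]mulrC mulrA; congr (_ * _).
  by apply: eq_bigr => i _; rewrite ltn_eqF.
by under eq_eseriesr do rewrite split_ind;
  under [X in (_ <= X)%E -> _]eq_eseriesr do rewrite split_ind.
Qed.

(** * Null sets in countable unions of hyperplanes *)

Lemma lebesgue_volume_ge0 (R : realType) (n : nat) (A : set 'rV[R]_n) :
  (0 <= lebesgue_volume A)%E.
Proof.
apply: le_ereal_inf_tmp => _ [ab [le_ab _] <-].
apply: nneseries_ge0 => k _ _; rewrite lee_fin.
by apply: prodr_ge0 => i _; rewrite subr_ge0.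
Qed.

(* The box with index [(t, N)] covers the part of the [t]-th hyperplane in the
   cube of side [2 (N + 1)]; its thickness makes its volume [e / 2 ^ (k + 1)],
   where [k] is the code of [(t, N)].  The dimension must be positive: in
   dimension 0 even the empty set has only covers of infinite volume. *)
Lemma lebesgue_volume_hyperplanes (R : realType) (n : nat) (T : countType)
    (i : T -> 'I_n.+1) (d : T -> R) (A : set 'rV[R]_n.+1) :
  (forall x, A x -> exists t, x 0 (i t) = d t) -> lebesgue_volume A = 0%E.
Proof.
move=> subA; apply/eqP; rewrite eq_le lebesgue_volume_ge0 andbT.
apply/lee_addgt0Pr => e e_gt0; rewrite add0e.
pose side (N : nat) : R := N.+1%:R + N.+1%:R.
have side_gt0 N : 0 < side N by rewrite addr_gt0.
pose thick (k N : nat) := e / (2 ^ k.+1)%:R / side N ^+ n.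
have thick_gt0 k N : 0 < thick k N.
  by rewrite !divr_gt0 ?exprn_gt0 // ltr0n expn_gt0.
(* Numbers that code no pair get the box [(0, 0)], of volume 0 in positive dimension. *)
pose box k : 'rV[R]_n.+1 * 'rV[R]_n.+1 :=
  if @unpickle (T * nat)%type k is Some (t, N) then
    (\row_l (if l == i t then d t - thick k N else - N.+1%:R),
     \row_l (if l == i t then d t else N.+1%:R))
  else (0, 0).
have le_box k l : (box k).1 0 l <= (box k).2 0 l.
  rewrite /box; case: unpickle => [[t N]|] //=; rewrite !mxE.
  case: ifP => _; first by rewrite gerBl ltW.
  by rewrite -subr_ge0 opprK ltW.
have box_vol k : box_volume (box k).1 (box k).2 <= e / (2 ^ k.+1)%:R.
  rewrite /box_volume /box; case: unpickle => [[t N]|] /=; last first.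
    rewrite big_ord_recl !mxE subrr mul0r.
    by rewrite divr_ge0 ?ltW // ltr0n expn_gt0.
  rewrite (bigD1 (i t)) //= !mxE eqxx opprB addrC subrK.
  rewrite (eq_bigr (fun=> side N)) => [|l /negPf l_ne]; last first.
    by rewrite !mxE l_ne opprK.
  rewrite prodr_const cardC1 card_ord /= /thick divfK //.
  by rewrite expf_neq0 // gt_eqF.
apply: (@le_trans _ _ (\sum_(0 <= k <oo) (box_volume (box k).1 (box k).2)%:E)%E).
  apply: ereal_inf_lbound; exists box => //; split => // x Ax.
  have [t xt] := subA x Ax.
  (* The sum bounds every [|x_l|], so all coordinates are below [N + 1] in absolute value. *)
  pose N := Num.truncn (\sum_l `|x 0 l|).
  exists (pickle (t, N)) => //; rewrite /box pickleK => l /=; rewrite !mxE.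
  case: eqP => [->|_]; first by rewrite xt lexx gtrBl thick_gt0.
  have : `|x 0 l| < N.+1%:R.
    apply: le_lt_trans (truncnS_gt _).
    by rewrite (bigD1 l) //= lerDl sumr_ge0.
  by rewrite ltr_norml => /andP[-> /ltW ->].
apply: le_trans (epsilon_trick0 xpredT (ltW e_gt0)).
apply: lee_nneseries => k _; rewrite lee_fin //.
by move=> _; apply: prodr_ge0 => l _; rewrite subr_ge0.
Qed.

(** * Determinant bound for parallelotopes in the staircase *)

Lemma norm_det_le (R : numDomainType) (n : nat) (M : 'M[R]_n) (c : R) :
  (forall s : 'S_n, \prod_i `|M i (s i)| <= c) -> `|\det M| <= n`!%:R * c.
Proof.
move=> le_c; apply: le_trans (ler_norm_sum _ _ _) _.
have -> : n`!%:R * c = \sum_(s : 'S_n) c.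
  rewrite sumr_const mulr_natl; congr (_ *+ _).
  by rewrite -(@eq_card _ predT) ?card_Sn.
by apply: ler_sum => s _; rewrite normrM normr_sign mul1r normr_prod.
Qed.

Definition step_lo (R : realType) (m j : nat) : 'rV[R]_m.+2 :=
  \row_i (if i == ord0 then 2 ^+ j else 0).

(** The exponent [j.+1] in the last coordinate puts the upper corner on the hyperbola, where the
    product of the first and last coordinates is largest. *)
Definition step_hi (R : realType) (m : nat) (c : R) (j : nat) : 'rV[R]_m.+2 :=
  \row_i (if i == ord0 then 2 ^+ j.+1
          else if i == ord_max then c / 2 ^+ j.+1 else 1).

Definition staircase (R : realType) (m : nat) (c : R) : set 'rV[R]_m.+2 :=
  \bigcup_j half_open_box (step_lo R m j) (step_hi m c j).

Lemma staircase_middle (R : realType) (m : nat) (c : R) (x : 'rV[R]_m.+2) i :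
  staircase c x -> i != ord0 -> i != ord_max -> 0 < x 0 i <= 1.
Proof.
by move=> [j _ /(_ i)] + /negPf i0 /negPf im; rewrite !mxE i0 im.
Qed.

Lemma staircase_hyperbola (R : realType) (m : nat) (c : R) (x : 'rV[R]_m.+2) :
  staircase c x ->
  [/\ 0 < x 0 ord0, 0 < x 0 ord_max & x 0 ord0 * x 0 ord_max <= c].
Proof.
move=> [j _ xj].
have := xj ord0; rewrite !mxE eqxx => /andP[x0_gt x0_le].
have := xj ord_max; rewrite !mxE /= eqxx => /andP[xm_gt0 xm_le].
have pow_gt0 k : 0 < 2 ^+ k :> R by rewrite exprn_gt0.
split => //; first exact: lt_trans x0_gt.
apply: (@le_trans _ _ (2 ^+ j.+1 * (c / 2 ^+ j.+1))); last first.
  by rewrite mulrC divfK // gt_eqF.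
by rewrite ler_pM // ltW // (lt_trans _ x0_gt).
Qed.

Lemma parallelotope_vertexE (R : realType) (n : nat) (p : 'rV[R]_n)
    (v : 'M[R]_n) (T : {set 'I_n}) k :
  parallelotope_vertex p v T 0 k = p 0 k + \sum_(j in T) v j k.
Proof.
by rewrite mxE summxE; congr (_ + _); apply: eq_bigr => j _; rewrite mxE.
Qed.

(** For [a > 0] both [y] and [y'] lie in []0, c / a]]; the product form also covers [a = 0]. *)
Lemma norm_dist_hyperbola (R : realDomainType) (a c x y x' y' : R) :
  0 <= a -> a <= x -> a <= x' -> 0 < y -> 0 < y' ->
  x * y <= c -> x' * y' <= c -> a * `|y' - y| <= c.
Proof.
move=> a_ge0 ax ax' y_gt0 y'_gt0 xy_le xy'_le.
have ay : a * y <= c by apply: le_trans xy_le; rewrite ler_wpM2r // ltW.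
have ay' : a * y' <= c by apply: le_trans xy'_le; rewrite ler_wpM2r // ltW.
have [yy'|y'y] := leP y y'.
- rewrite ger0_norm ?subr_ge0 //; apply: le_trans ay'.
  by rewrite ler_wpM2l // gerBl ltW.
- rewrite ltr0_norm ?subr_lt0 // opprB; apply: le_trans ay.
  by rewrite ler_wpM2l // gerBl ltW.
Qed.

Section Parallelotope.
Variables (R : realType) (m : nat) (c : R).
Variables (p : 'rV[R]_m.+2) (v : 'M[R]_m.+2).
Hypothesis vertices : forall T, staircase c (parallelotope_vertex p v T).

(** The entry is the difference of two numbers in []0, 1]], the coordinates of [p + v_i] and [p]. *)
Lemma edge_middle_le1 i k : k != ord0 -> k != ord_max -> `|v i k| <= 1.
Proof.
move=> k0 km.
have := staircase_middle (vertices finset.set0) k0 km.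
have := staircase_middle (vertices [set i]%SET) k0 km.
rewrite !parallelotope_vertexE big_set0 big_set1 addr0.
move=> /andP[pv_gt0 pv_le1] /andP[p_gt0 p_le1]; rewrite ler_norml; apply/andP.
split; lra.
Qed.

(* Of the two parallel edges in direction [i] that differ by [v_j], the one with
   the larger [x_0] has both its endpoints at [x_0 >= |v_j0|]. *)
Lemma edge_hyperbola i j : i != j -> `|v j ord0| * `|v i ord_max| <= c.
Proof.
move=> ij.
have sum2 k : \sum_(l in [set i; j]%SET) v l k = v i k + v j k.
  by rewrite big_setU1 ?inE //= big_set1.
have := staircase_hyperbola (vertices finset.set0).
have := staircase_hyperbola (vertices [set i]%SET).
have := staircase_hyperbola (vertices [set j]%SET).
have := staircase_hyperbola (vertices [set i; j]%SET).
rewrite !parallelotope_vertexE !sum2 !big_set1 !big_set0 !addr0.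
move=> [x3 y3 xy3] [x2 y2 xy2] [x1 y1 xy1] [x0 y0 xy0].
(* The edge starts at [p + v_j] in the first case and at [p] in the second; positivity of [x_0] on
   the opposite edge bounds [x_0] from below on this one. *)
have [a_ge0|a_lt0] := leP 0 (v j ord0).
- rewrite (ger0_norm a_ge0).
  have -> : v i ord_max =
    p 0 ord_max + (v i ord_max + v j ord_max) - (p 0 ord_max + v j ord_max) by ring.
  apply: norm_dist_hyperbola xy2 xy3 => //; lra.
- rewrite (ltr0_norm a_lt0).
  have -> : v i ord_max = p 0 ord_max + v i ord_max - p 0 ord_max by ring.
  apply: norm_dist_hyperbola xy0 xy1 => //; lra.
Qed.

Lemma parallelotope_volume_le : parallelotope_volume v <= m.+2`!%:R * c.
Proof.
apply: norm_det_le => s.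
(* Rows [j] and [i] supply the entries of the first and last columns, whose product is at most [c];
   all other factors are at most 1. *)
pose j := (s^-1)%g ord0; pose i := (s^-1)%g ord_max.
have sj : s j = ord0 by rewrite permKV.
have si : s i = ord_max by rewrite permKV.
have ij : i != j by apply/eqP => eq_ij; move: si; rewrite eq_ij sj.
rewrite (bigD1 j) //= (bigD1 i) //= sj si mulrA.
apply: le_trans (edge_hyperbola ij).
rewrite ler_piMr // prodr_ile1 // => k /andP[kj ki]; rewrite normr_ge0 /=.
by apply: edge_middle_le1; rewrite -?sj -?si (inj_eq perm_inj).
Qed.

End Parallelotope.

(** * Dyadic intervals and volumes of disjoint boxes *)

Lemma dyadic_unique (R : realDomainType) (t : R) (j k : nat) :
  2 ^+ j < t <= 2 ^+ j.+1 -> 2 ^+ k < t <= 2 ^+ k.+1 -> j = k.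
Proof.
move=> /andP[jt tj] /andP[kt tk]; apply/eqP; rewrite eqn_leq -ltnS -(ltnS k).
have two_gt1 : 1 < 2 :> R by rewrite ltr1n.
by rewrite -!(ltr_eXn2l two_gt1) (lt_le_trans jt tk) (lt_le_trans kt tj).
Qed.

Lemma dyadic_exists (R : archiRealDomainType) (t : R) :
  1 < t -> exists j, 2 ^+ j < t <= 2 ^+ j.+1.
Proof.
move=> t_gt1.
have ex_j : exists j, t <= 2 ^+ j.
  exists (Num.truncn t).+1; apply: (le_trans (ltW (truncnS_gt t))).
  by rewrite -natrX ler_nat ltnW // ltn_expl.
(* The least exponent is positive because [1 < t]; its predecessor is the witness. *)
case: (ex_minnP ex_j) => -[|j] t_le j_min.
  by move: t_le; rewrite expr0 leNgt t_gt1.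
exists j; rewrite t_le andbT ltNge; apply/negP => /j_min.
by rewrite ltnn.
Qed.

Lemma prodr_indicator (R : comNzRingType) (I : finType) (P : pred I) :
  \prod_i (P i)%:R = [forall i, P i]%:R :> R.
Proof.
have [/forallP allP | /forallPn[i /negPf Pi]] := boolP [forall i, P i].
  by rewrite big1 // => i _; rewrite allP.
by rewrite (bigD1 i) //= Pi mul0r.
Qed.

(** The indicators of disjoint boxes add up to at most 1, and those of a cover to at least 1 on the
    union; [le_series_box_volume] turns this into an inequality of volumes. *)
Lemma le_lebesgue_volume_bigcup (R : realType) (n : nat)
    (lo hi : nat -> 'rV[R]_n.+1) :
  (forall k i, lo k 0 i <= hi k 0 i) ->
  trivIset setT (fun k => half_open_box (lo k) (hi k)) ->
  (\sum_(0 <= k <oo) (box_volume (lo k) (hi k))%:E <=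
   lebesgue_volume (\bigcup_k half_open_box (lo k) (hi k)))%E.
Proof.
move=> le_lh disj; apply: le_ereal_inf_tmp => _ [ab [le_ab cover] <-].
pose coord (a : 'rV[R]_n.+1) (i : nat) := a 0 (inord i).
have volE a b : box_volume a b = 1 * \prod_(i < n.+1) (coord b i - coord a i).
  by rewrite mul1r; apply: eq_bigr => i _; rewrite /coord inord_val.
under eq_eseriesr do rewrite volE.
under [X in (_ <= X)%E]eq_eseriesr do rewrite volE.
apply: (@le_series_box_volume R n.+1 (fun=> 1) (fun=> 1)
  (fun k => coord (lo k)) (fun k => coord (hi k))
  (fun k => coord (ab k).1) (fun k => coord (ab k).2)) => // [k i|k i|x].
- exact: le_lh.
- exact: le_ab.
pose y : 'rV[R]_n.+1 := \row_i x i.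
have indE a b : 1 * \prod_(i < n.+1) (coord a i < x i <= coord b i)%R%:R =
    (y \in half_open_box a b)%:R :> R.
  rewrite mul1r (@prodr_indicator _ _ (fun i : 'I_n.+1 => coord a i < x i <= coord b i)).
  congr (nat_of_bool _)%:R; apply/forallP/idP => [yP | /set_mem yP i].
    by apply/mem_set => i; have := yP i; rewrite /coord inord_val mxE.
  by have := yP i; rewrite /coord inord_val mxE.
under eq_eseriesr do rewrite indE.
under [X in (_ <= X)%E]eq_eseriesr do rewrite indE.
have [[j yj]|y_out] := pselect (exists j, half_open_box (lo j) (hi j) y).
- have [k _ yk] : (\bigcup_k half_open_box (ab k).1 (ab k).2) y.
    by apply: cover; exists j.
  rewrite (nneseriesD1 (n := j)) // [X in (_ <= X)%E](nneseriesD1 (n := k)) //.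
  rewrite [X in (_ + X <= _)%E]eseries0 => [|i _ /= i_ne_j]; last first.
    rewrite memNset // => yi; case/eqP: i_ne_j.
    by apply: disj => //; exists y.
  rewrite !mem_set // leeD2l // nneseries_ge0 // => i _ _; exact: lee_fin.
- rewrite eseries0 => [|i _ _]; first by apply: nneseries_ge0 => k _ _; rewrite lee_fin.
  by rewrite memNset // => yi; apply: y_out; exists i.
Qed.

(** * Infinite volume and null boundary of the staircase *)

Lemma nbhs_coord_lt (R : realType) (n : nat) (x : 'rV[R]_n) i (t : R) :
  x 0 i < t -> \forall y \near x, (y : 'rV[R]_n) 0 i < t.
Proof. by move=> xt; apply: cvgr_lt (@coord_continuous R 1 n 0 i x) _ xt. Qed.

Lemma nbhs_coord_gt (R : realType) (n : nat) (x : 'rV[R]_n) i (t : R) :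
  t < x 0 i -> \forall y \near x, t < (y : 'rV[R]_n) 0 i.
Proof. by move=> tx; apply: cvgr_gt (@coord_continuous R 1 n 0 i x) _ tx. Qed.

Section Staircase.
Variables (R : realType) (m : nat) (c : R).
Hypothesis c_gt0 : 0 < c.

Lemma le_step j i : step_lo R m j 0 i <= step_hi m c j 0 i.
Proof.
rewrite !mxE; case: ifP => _; first by rewrite ler_eXn2l ?ltr1n.
by case: ifP => // _; rewrite ltW // divr_gt0 ?exprn_gt0.
Qed.

Lemma step_volume j : box_volume (step_lo R m j) (step_hi m c j) = c / 2.
Proof.
rewrite /box_volume big_ord_recl big_ord_recr /= !mxE /=.
have -> : lift ord0 (@ord_max m) == ord_max by exact/eqP/val_inj.
rewrite big1 => [|i _]; last first.
  rewrite !mxE /= subr0; case: eqP => // /(congr1 val) /=; rewrite /bump /= => im.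
  by have := ltn_ord i; rewrite -ltnS -[X in (_ < X)%N]im ltnn.
have pow_neq0 : 2 ^+ j != 0 :> R by rewrite expf_neq0 // pnatr_eq0.
by rewrite exprS; field.
Qed.

Lemma staircase_volume : lebesgue_volume (staircase (m := m) c) = +oo%E.
Proof.
apply/eqyP => M M_gt0.
apply: le_trans (le_lebesgue_volume_bigcup le_step _); last first.
  move=> j k _ _ [x [xj xk]]; apply: (@dyadic_unique R (x 0 ord0)).
  - by have := xj ord0; rewrite !mxE.
  - by have := xk ord0; rewrite !mxE.
under eq_eseriesr do rewrite step_volume.
have c2_gt0 : 0 < c / 2 by rewrite divr_gt0.
(* More than [M / (c / 2)] terms, each equal to [c / 2], already add up to at least [M]. *)
apply: le_trans (nneseries_lim_ge (Num.truncn (M / (c / 2))).+1 _); last first.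
  by move=> k _ _; rewrite lee_fin ltW.
rewrite sumEFin sumr_const_nat subn0 lee_fin -[leRHS]mulr_natl -ler_pdivrMr //.
by rewrite ltW // truncnS_gt.
Qed.

(* Off the hyperplanes through the faces of the boxes, [x_0] selects a single
   box, and membership in that box is locally constant. *)
Lemma boundary_staircase x : boundary (staircase (m := m) c) x ->
  exists t : bool * nat * 'I_m.+2,
    x 0 t.2 = (if t.1.1 then step_lo R m t.1.2 else step_hi m c t.1.2) 0 t.2.
Proof.
move=> [x_cl x_int]; apply: contrapT => /forallNP x_off.
have x_lo j i : x 0 i != step_lo R m j 0 i.
  by apply/eqP => xE; apply: (x_off (true, j, i)).
have x_hi j i : x 0 i != step_hi m c j 0 i.
  by apply/eqP => xE; apply: (x_off (false, j, i)).
(* Closure points have [x_0 >= 1], and equality would put [x] on the lower face of step 0. *)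
have x0_gt1 : 1 < x 0 ord0.
  rewrite ltNge le_eqVlt; apply/negP => /orP[/eqP x0_eq|x0_lt].
    by have := x_lo 0 ord0; rewrite mxE eqxx expr0 x0_eq eqxx.
  have [y [[j _ /(_ ord0)]]] := x_cl _ (nbhs_coord_lt x0_lt).
  rewrite !mxE eqxx => /andP[+ _] /= y_lt1 => /lt_trans /(_ y_lt1).
  by rewrite ltNge exprn_ege1 // ler1n.
have [j /andP[jx xj]] := dyadic_exists x0_gt1.
have {}xj : x 0 ord0 < 2 ^+ j.+1.
  by rewrite lt_neqAle xj andbT; have := x_hi j ord0; rewrite mxE eqxx.
have near_j : \forall y \near x,
    staircase c y -> half_open_box (step_lo R m j) (step_hi m c j) y.
  near=> y => -[k _ yk]; suff -> : j = k by [].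
  apply: (@dyadic_unique R (y 0 ord0)); last by have := yk ord0; rewrite !mxE.
  apply/andP; split; last apply: ltW; near: y.
  - exact: nbhs_coord_gt.
  - exact: nbhs_coord_lt.
apply: x_int; rewrite /interior.
(* A coordinate beyond a face would stay beyond it near [x], but [x] has points of box [j]
   arbitrarily near. *)
have in_box i : step_lo R m j 0 i < x 0 i < step_hi m c j 0 i.
  have lo_lt : step_lo R m j 0 i < x 0 i.
    rewrite lt_neqAle eq_sym x_lo /= leNgt; apply/negP => x_lt.
    have [y [Ay [/(_ Ay) /(_ i) /andP[lo_y _] /(lt_trans lo_y)]]] :=
      x_cl _ (filterI near_j (nbhs_coord_lt x_lt)).
    by rewrite ltxx.
  rewrite lo_lt lt_neqAle x_hi /= leNgt; apply/negP => lt_x.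
  have [y [Ay [/(_ Ay) /(_ i) /andP[_ y_hi] /lt_le_trans /(_ y_hi)]]] :=
    x_cl _ (filterI near_j (nbhs_coord_gt lt_x)).
  by rewrite ltxx.
(* These finitely many strict inequalities persist near [x], which makes [x] an interior point. *)
pose inside i : set 'rV[R]_m.+2 :=
  [set y | step_lo R m j 0 i < y 0 i < step_hi m c j 0 i].
have : nbhs x (fun y => forall i, inside i y).
  apply: (@filter_forall _ _ inside _ (nbhs_filter x)) => i; have /andP[lo_x x_hi_i] := in_box i.
  by apply: filterS2 (nbhs_coord_gt lo_x) (nbhs_coord_lt x_hi_i) => y; rewrite /inside /= => -> ->.
apply: filterS => y yP; exists j => // i.
by have /andP[-> /ltW ->] := yP i.
Unshelve. all: by end_near.
Qed.

Lemma jordan_measurable_staircase : jordan_measurable (staircase (m := m) c).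
Proof.
exact: lebesgue_volume_hyperplanes boundary_staircase.
Qed.

End Staircase.

Theorem theorem7 (R : realType) (n : nat) (eps : R)
    (n_ge2 : (2 <= n)%N) (eps_gt0 : 0 < eps) :
  exists A : set 'rV[R]_n,
    [/\ jordan_measurable A,
        lebesgue_volume A = +oo%E &
        forall (p : 'rV[R]_n) (v : 'M[R]_n),
          row_free v ->
          (forall T : {set 'I_n}, A (parallelotope_vertex p v T)) ->
          parallelotope_volume v < eps].
Proof.
case: n n_ge2 => [|[|m]] // _.
(* The factor 2 makes the bound [n! c] equal to [eps / 2], strictly below [eps]. *)
pose c := eps / (2 * m.+2`!%:R).
have nfact_gt0 : 0 < m.+2`!%:R :> R by rewrite ltr0n fact_gt0.
have c_gt0 : 0 < c by rewrite divr_gt0 // mulr_gt0.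
exists (staircase c); split.
- exact: jordan_measurable_staircase.
- exact: staircase_volume.
- move=> p v _ /parallelotope_volume_le vol_le; apply: le_lt_trans vol_le _.
  have -> : m.+2`!%:R * c = eps / 2 by rewrite /c; field; rewrite gt_eqF.
  lra.
Qed.
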